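(* Let $\mathcal{F}=\{w_1,\dots,w_N\}$ be a topologically contractive IFS (TIFS) on a nonempty Hausdorff topological space $X$, let $A_{\mathcal{F}}$ be its attractor, and let $\vec p=(p_1,\dots,p_N)$ with $p_i>0$, $\sum_{i=1}^N p_i=1$. Let $M:\mathcal{P}(X)\to\mathcal{P}(X)$, $M(\mu)=\sum_{i=1}^N p_i\,\mu\circ w_i^{-1}$. Then there is $\mu_*\in\mathcal{P}(X)$ such that: (i) $M(\mu_* )=\mu_*$ and $M^n(\mu)$ converges weakly to $\mu_*$ for every $\mu\in\mathcal{P}(X)$; (ii) $\operatorname{supp}(\mu_* )=A_{\mathcal{F}}$; (iii) $\mu_*$ is the unique invariant measure of $M$ among Radon probability measures with compact support; and if additionally $X$ is normal, then $\mu_*$ is the unique invariant measure of $M$ among all Radon probability measures on $X$.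
   Context: $\mathcal{K}(X)$ is the set of nonempty compact subsets of $X$, with the Vietoris topology (subbase: $\{K:K\subseteq V\}$, $\{K:K\cap V\neq\emptyset\}$, $V$ open). For continuous $w_1,\dots,w_N:X\to X$ put $\mathcal{F}(K)=\bigcup_{i=1}^N w_i(K)$, $K\in\mathcal{K}(X)$. Let $I=\{1,\dots,N\}$; for $\alpha\in I^\infty$ write $w_{\alpha_{|k}}=w_{\alpha_1}\circ\cdots\circ w_{\alpha_k}$. $\mathcal{F}$ is a TIFS if all $w_i$ are continuous and: (1) for every $K\in\mathcal{K}(X)$ there is $C\in\mathcal{K}(X)$ with $K\subseteq C$, $\mathcal{F}(C)\subseteq C$; (2) for every $C\in\mathcal{K}(X)$ with $\mathcal{F}(C)\subseteq C$ and every $\alpha\in I^\infty$, $\bigcap_{k}w_{\alpha_{|k}}(C)$ is a singleton. A TIFS on a nonempty Hausdorff space has a unique attractor, i.e. a set $A_{\mathcal{F}}\in\mathcal{K}(X)$ with $\mathcal{F}(A_{\mathcal{F}})=A_{\mathcal{F}}$ and $\mathcal{F}^k(K)\to A_{\mathcal{F}}$ in the Vietoris topology for every $K\in\mathcal{K}(X)$. $\mathcal{P}(X)$ is the set of Radon probability measures on $X$: Borel probability measures $\mu$ with $\mu(B)=\sup\{\mu(K):K\subseteq B\text{ compact}\}$ for every Borel $B$. $\mu\circ w^{-1}$ is the push-forward. $\operatorname{supp}\mu=\{x:\mu(U)>0\text{ for every open }U\ni x\}$. Weak convergence $\mu_n\to\mu$ means $\int f\,d\mu_n\to\int f\,d\mu$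 for all bounded continuous $f:X\to\mathbb{R}$ (weak limits need not be unique if $X$ is not normal). An invariant measure of $M$ is a fixed point of $M$. Normal spaces are assumed Hausdorff. *)

(* Defs.v *)
From HB Require Import structures.
From mathcomp Require Import all_boot all_order all_algebra.
From mathcomp Require Import all_classical all_reals all_analysis giry.

Set Implicit Arguments.
Unset Strict Implicit.
Unset Printing Implicit Defensive.

Import Order.TTheory GRing.Theory Num.Theory.
Import numFieldNormedType.Exports.

Local Open Scope classical_set_scope.
Local Open Scope ring_scope.

Record compacts (X : topologicalType) := Compacts {
  compacts_val :> set X;
  compacts_compact : compact compacts_val;
  compacts_nonempty : compacts_val !=set0 }.

HB.instance Definition _ (X : topologicalType) := gen_eqMixin (compacts X).
HB.instance Definition _ (X : topologicalType) := gen_choiceMixin (compacts X).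

(* The index (b, V) stands for {K | K `<=` V} if b is true and for
   {K | K meets V} otherwise. *)
Definition vietoris_subbase (X : topologicalType) (bV : bool * set X) :
    set (compacts X) :=
  if bV.1 then [set K : compacts X | K `<=` bV.2]
  else [set K : compacts X | K `&` bV.2 !=set0].

HB.instance Definition _ (X : topologicalType) :=
  @isSubBaseTopological.Build (compacts X) (bool * set X)%type
    [set bV | open bV.2] (@vietoris_subbase X).

(* A family of N = n.+1 maps, so that N >= 1. *)
Section ifs.
Variables (X : topologicalType) (n : nat) (w : 'I_n.+1 -> continuousType X X).

Definition hutchinson_set (K : set X) : set X :=
  \bigcup_(i in [set: 'I_n.+1]) (w i @` K).

Lemma hutchinson_compact (K : compacts X) : compact (hutchinson_set K).
Proof.
have -> : hutchinson_set K = \big[setU/set0]_(i < n.+1) (w i @` K).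
  rewrite -bigcup_mkord_ord; apply/seteqP; split => x.
    by move=> [i _ Kx]; exists (val i) => //=; rewrite inord_val.
  by move=> [i _ Kx]; exists (inord i).
apply: bigsetU_compact => i _; apply: continuous_compact.
  by apply: continuous_subspaceT; exact: cts_fun.
exact: compacts_compact.
Qed.

Lemma hutchinson_nonempty (K : compacts X) : hutchinson_set K !=set0.
Proof.
by have [x Kx] := compacts_nonempty K; exists (w ord0 x), ord0 => //; exists x.
Qed.

Definition hutchinson (K : compacts X) : compacts X :=
  Compacts (@hutchinson_compact K) (@hutchinson_nonempty K).

(* w_(alpha 0) \o ... \o w_(alpha k.-1) *)
Fixpoint word_map (alpha : nat -> 'I_n.+1) (k : nat) : X -> X :=
  if k is k'.+1 then word_map alpha k' \o w (alpha k') else id.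

Definition tifs : Prop :=
  (forall K : compacts X,
     exists C : compacts X, K `<=` C /\ hutchinson C `<=` C) /\
  (forall C : compacts X, hutchinson C `<=` C ->
     forall alpha : nat -> 'I_n.+1,
     exists x, \bigcap_(k in [set k | (0 < k)%N]) (word_map alpha k @` C)
               = [set x]).

Definition attractor (A : compacts X) : Prop :=
  hutchinson A = A /\
  forall K : compacts X, iter k hutchinson K @[k --> \oo] --> A.

End ifs.

Definition borelType (X : ptopologicalType) := g_sigma_algebraType (@open X).
HB.instance Definition _ (X : ptopologicalType) := Measurable.on (borelType X).

Definition inner_regular (X : ptopologicalType) (R : realType)
    (mu : set (borelType X) -> \bar R) : Prop :=
  forall B : set (borelType X), measurable B ->
  mu B = ereal_sup [set mu K | K in [set K : set X | compact K /\ K `<=` B]].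

Record radonProbability (X : ptopologicalType) (R : realType) :=
  RadonProbability {
    radon_probability :> probability (borelType X) R;
    radon_inner_regular : inner_regular radon_probability }.

Record probVector (R : realType) (N : nat) := ProbVector {
  prob_vector :> 'I_N -> R;
  prob_vector_gt0 : forall i, 0 < prob_vector i;
  prob_vector_sum : \sum_i prob_vector i = 1 }.

Lemma borel_continuous_measurable (X : ptopologicalType) (f : X -> X) :
  continuous f -> measurable_fun [set: borelType X] (f : borelType X -> borelType X).
Proof.
move=> /continuousP cf.
apply: (@measurability _ _ (borelType X) (borelType X) setT f (@open X) erefl).
move=> _ [U oU <-].
by rewrite setTI; apply: sub_sigma_algebra; exact: cf.
Qed.

Lemma borel_compact_measurable (X : ptopologicalType) (K : set X) :
  hausdorff_space X -> compact K -> measurable (K : set (borelType X)).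
Proof.
move=> hX cK; rewrite -[K]setCK; apply: measurableC.
by apply: sub_sigma_algebra; apply: closed_openC; exact: compact_closed.
Qed.

Section markov.
Local Open Scope ereal_scope.
Variables (X : ptopologicalType) (R : realType) (n : nat).
Variables (w : 'I_n.+1 -> continuousType X X) (p : probVector R n.+1).

Definition markov_fun (mu : probability (borelType X) R)
    (B : set (borelType X)) : \bar R :=
  \sum_i (p i)%:E * pushforward mu (w i : borelType X -> borelType X) B.

Section instances.
Variable mu : probability (borelType X) R.

Let mw i (B : set (borelType X)) : measurable B ->
  measurable (w i @^-1` B : set (borelType X)).
Proof.
move=> mB; rewrite -[_ @^-1` _]setTI.
exact: (borel_continuous_measurable (@cts_fun _ _ (w i))).
Qed.

Let push_ge0 i (B : set (borelType X)) :
  0 <= pushforward mu (w i : borelType X -> borelType X) B.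
Proof. by rewrite /pushforward; exact: measure_ge0. Qed.

Let p_ge0 i : 0 <= (p i)%:E.
Proof. by rewrite lee_fin ltW// prob_vector_gt0. Qed.

Let markov0 : markov_fun mu set0 = 0.
Proof.
by rewrite /markov_fun big1// => i _; rewrite /pushforward preimage_set0 measure0 mule0.
Qed.

Let markov_ge0 B : 0 <= markov_fun mu B.
Proof. by apply: sume_ge0 => i _; exact: mule_ge0. Qed.

Let markov_sigma_additive : semi_sigma_additive (markov_fun mu).
Proof.
move=> F mF tF mUF; rewrite /markov_fun.
under eq_fun do rewrite exchange_big/=.
apply: cvg_nnesum => i _.
  by apply: nearW => k; apply: sume_ge0 => j _; exact: mule_ge0.
under eq_fun do rewrite -ge0_sume_distrr//.
apply: cvgeZl => //; rewrite /pushforward preimage_bigcup.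
apply: measure_semi_sigma_additive.
- by move=> k; exact: mw.
- apply/trivIsetP => j k _ _ jk; rewrite -preimage_setI.
  by move/trivIsetP : tF => ->//; rewrite preimage_set0.
- by rewrite -preimage_bigcup; exact: mw.
Qed.

HB.instance Definition _ := isMeasure.Build _ _ _ (markov_fun mu)
  markov0 markov_ge0 markov_sigma_additive.

Let markov_setT : markov_fun mu [set: borelType X] = 1.
Proof.
rewrite /markov_fun /pushforward.
under eq_bigr do rewrite preimage_setT probability_setT mule1.
by rewrite sumEFin prob_vector_sum.
Qed.

HB.instance Definition _ :=
  Measure_isProbability.Build _ _ _ (markov_fun mu) markov_setT.

Lemma markov_inner_regular : hausdorff_space X ->
  inner_regular mu -> inner_regular (markov_fun mu).
Proof.
move=> hX rmu B mB; apply/eqP; rewrite eq_le; apply/andP; split; last first.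
  apply: ge_ereal_sup => _ [K [cK KB] <-]; apply: le_measure => //; rewrite inE//.
  exact: borel_compact_measurable.
apply/lee_addgt0Pr => e e0.
have HK i : exists K : set X, [/\ compact K, K `<=` w i @^-1` B &
    mu (w i @^-1` B) <= mu K + e%:E].
  have mwB := mw i mB.
  have fin : ereal_sup [set mu K | K in [set K : set X |
      compact K /\ K `<=` w i @^-1` B]] \is a fin_num.
    by rewrite -rmu//; exact: fin_num_measure.
  have [_ [K [cK KB] <-] lt] := ub_ereal_sup_adherent e0 fin.
  exists K; split => //; rewrite -leeBlDr//.
  by rewrite rmu//; exact: ltW.
have [K HKi] := choice HK.
pose L : set X := \big[setU/set0]_(i < n.+1) (w i @` K i).
have cL : compact L.
  apply: bigsetU_compact => i _; apply: continuous_compact.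
    by apply: continuous_subspaceT; exact: cts_fun.
  by have [] := HKi i.
have LE x : L x <-> exists i, (w i @` K i) x.
  rewrite /L -bigcup_mkord_ord; split.
    by move=> [i _ Kx]; exists (inord i).
  by move=> [i Kx]; exists (val i) => //=; rewrite inord_val.
have LB : L `<=` B.
  by move=> x /LE[i [y Ky <-]]; have [_ + _] := HKi i; exact.
have mL : measurable (L : set (borelType X)) by exact: borel_compact_measurable.
apply: (@le_trans _ _ (markov_fun mu L + e%:E)); last first.
  by rewrite leeD2r//; apply: ereal_sup_ubound; exists L.
have -> : e%:E = \sum_i (p i)%:E * e%:E.
  by rewrite -ge0_sume_distrl// sumEFin prob_vector_sum mul1e.
rewrite /markov_fun -big_split/=; apply: lee_sum => i _.
rewrite -muleDr//; last by rewrite fin_num_adde_defl.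
apply: lee_wpmul2l => //; rewrite /pushforward.
have [cK KB /le_trans] := HKi i; apply; rewrite leeD2r//.
apply: le_measure; rewrite ?inE; [exact: borel_compact_measurable|exact: mw|].
by move=> x Kx /=; apply/LE; exists i, x.
Qed.

End instances.

Definition markov_operator (hX : hausdorff_space X) (mu : radonProbability X R) :
    radonProbability X R :=
  @RadonProbability X R (markov_fun mu)
    (markov_inner_regular hX (@radon_inner_regular X R mu)).

End markov.

(* Measures are functions on all sets that are only constrained on measurable
   ones, so equality of measures is rendered by `measure_eq`. *)
Definition invariant_measure (X : ptopologicalType) (R : realType)
    (M : radonProbability X R -> radonProbability X R)
    (mu : radonProbability X R) : Prop :=
  measure_eq (M mu) mu.

Definition msupport (X : ptopologicalType) (R : realType)
    (mu : radonProbability X R) : set X :=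
  [set x | forall U : set X, open U -> U x -> (0 < mu U)%E].

Definition weakly_converges (X : ptopologicalType) (R : realType)
    (mu_ : nat -> radonProbability X R) (mu : radonProbability X R) : Prop :=
  forall f : X -> R, continuous f -> bounded_fun f ->
  \int[mu_ k]_x f x @[k --> \oo] --> \int[mu]_x f x.

(* Main.v *)
Require Import Defs.
From HB Require Import structures.
From mathcomp Require Import all_boot all_order all_algebra.
From mathcomp Require Import all_classical all_reals all_analysis giry.
From mathcomp Require Import measurable_realfun ring lra.

Set Implicit Arguments.
Unset Strict Implicit.
Unset Printing Implicit Defensive.

Import Order.TTheory GRing.Theory Num.Theory.
Import numFieldNormedType.Exports.

Local Open Scope classical_set_scope.
Local Open Scope ring_scope.

(** Compactness makes the images [w_u(C)] of a compact forward-invariant set [C]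
    uniformly small for long words [u] (König's lemma along the tree of words).
    By tightness any two Radon probability measures live, up to [e], on a common
    such [C], so after many steps [M^k mu] and [M^k nu] cannot be told apart by a
    pair of functions [F], [G] with [F + G <= b] locally: this yields weak
    convergence ([F = f + B], [G = B - f]) and uniqueness (indicators of disjoint
    compact sets, followed by inner regularity).

    For existence, [mu_star] is the image of Lebesgue measure on [[0, 1[] under
    the map sending [x] to the point of the attractor coded by the digits of [x]
    in the expansion attached to the subdivision of [[0, 1[] into consecutive
    intervals of lengths [p_i]. Self-similarity of Lebesgue measure under the
    inverse branches gives invariance, and continuity of the digits off a null
    set transfers inner regularity. *)

(** * Compactness and images under long words *)

Lemma nested_compact_sub (X : topologicalType) (hX : hausdorff_space X)
    (F : nat -> set X) (V : set X) :
  (forall k, compact (F k)) -> (forall k, F k.+1 `<=` F k) ->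
  open V -> \bigcap_k F k `<=` V -> exists k, F k `<=` V.
Proof.
move=> cF dF oV FV.
have anti j k : (j <= k)%N -> F k `<=` F j.
  elim: k => [|k IH]; first by rewrite leqn0 => /eqP->.
  rewrite leq_eqVlt => /orP[/eqP->//|jk x Fx].
  exact: IH jk _ (dF _ _ Fx).
(* Near-covering form of compactness of [F 0], with [\oo] as filter of indices: a point of [V]
   imposes no index, a point outside [V] has a neighbourhood missing some closed [F j]. One index
   then serves all of [F 0]. *)
have /compact_near_coveringP/(_ _ \oo (fun k y => ~ F k y \/ V y)) := cF 0%N.
case.
  move=> x _; have [Vx|nVx] := pselect (V x).
    exists (V, setT) => /=; last by move=> [y k] [/= Vy _]; right.
    by split; [exact: open_nbhs_nbhs|exact: filterT].
  have [j nFj] : exists j, ~ F j x.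
    by apply/existsNP => Fx; apply/nVx/FV => k _; exact: Fx.
  exists (~` F j, [set k | (j <= k)%N]) => /=.
    split; last exact: nbhs_infty_ge.
    apply: open_nbhs_nbhs; split => //.
    by apply: closed_openC; exact: compact_closed.
  by move=> [y k] [/= nFy jk]; left => /(anti _ _ jk).
move=> k _ /(_ k (leqnn k)) FkV; exists k => x Fkx.
by have [|//] := FkV x (anti _ _ (leq0n k) _ Fkx).
Qed.

Section words.
Variables (X : topologicalType) (n : nat) (w : 'I_n.+1 -> continuousType X X).
Implicit Types (alpha beta : nat -> 'I_n.+1) (C D : set X).

Definition scons i alpha : nat -> 'I_n.+1 :=
  fun k => if k is k'.+1 then alpha k' else i.

(** [word_map] recurses on the innermost letter; self-similarity arguments peel off the outermost
    one instead. *)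
Lemma word_map_scons i alpha k :
  word_map w (scons i alpha) k.+1 = w i \o word_map w alpha k.
Proof. by elim: k => // k IH; rewrite [LHS]/= -/(word_map _ _ k.+1) IH. Qed.

Lemma word_mapS alpha k :
  word_map w alpha k.+1 = w (alpha 0%N) \o word_map w (alpha \o S) k.
Proof.
rewrite -word_map_scons; congr (word_map w _ _).
by apply/funext; case.
Qed.

Lemma eq_word_map alpha beta k : (forall j, (j < k)%N -> alpha j = beta j) ->
  word_map w alpha k = word_map w beta k.
Proof.
elim: k => //= k IH ab; rewrite ab// IH// => j jk.
by apply: ab; exact: ltnW.
Qed.

Lemma word_map_continuous alpha k : continuous (word_map w alpha k).
Proof.
elim: k => [|k IH] x /=; first exact: cvg_id.
by apply: continuous_comp; [exact: cts_fun|exact: IH].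
Qed.

Lemma word_map_compact alpha k C : compact C -> compact (word_map w alpha k @` C).
Proof.
apply: continuous_compact; apply: continuous_subspaceT.
exact: word_map_continuous.
Qed.

Lemma hutchinson_sub i C : hutchinson_set w C `<=` C -> forall x, C x -> C (w i x).
Proof. by move=> wC x Cx; apply: wC; exists i => //; exists x. Qed.

Lemma word_map_stable alpha k C : hutchinson_set w C `<=` C ->
  forall x, C x -> C (word_map w alpha k x).
Proof.
move=> wC; elim: k => //= k IH x Cx; apply: IH; exact: hutchinson_sub.
Qed.

Lemma word_map_anti alpha k C : hutchinson_set w C `<=` C ->
  word_map w alpha k.+1 @` C `<=` word_map w alpha k @` C.
Proof.
move=> wC _ [x Cx <-]; exists (w (alpha k) x) => //; exact: hutchinson_sub.
Qed.

Lemma word_map_image_sub (hX : hausdorff_space X) (hw : tifs w)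
    (C : compacts X) alpha x (V : set X) : hutchinson_set w C `<=` C ->
  \bigcap_(k in [set k | (0 < k)%N]) (word_map w alpha k @` C) = [set x] ->
  open V -> V x -> exists k, word_map w alpha k @` C `<=` V.
Proof.
move=> wC Cx oV Vx.
apply: nested_compact_sub => //.
- by move=> k; apply: word_map_compact; exact: compacts_compact.
- by move=> k; exact: word_map_anti.
move=> y Fy; have -> // : y = x.
by have : [set x] y by rewrite -Cx => k _; exact: Fy.
Qed.

(* [P g k] reads: every word of length [k] appended to the prefix [g] is good. *)
Lemma koenig (P : (X -> X) -> nat -> Prop) :
  (forall g k, P g k -> P g k.+1) ->
  (forall g k, (forall i, P (g \o w i) k) -> P g k.+1) ->
  (forall alpha, exists k, P (word_map w alpha k) 0%N) -> exists k, P id k.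
Proof.
move=> Pmono PS Pbr; apply: contrapT => nP.
have Pge g j k : (j <= k)%N -> P g j -> P g k.
  elim: k => [|k IH]; first by rewrite leqn0 => /eqP->.
  by rewrite leq_eqVlt => /orP[/eqP->//|jk /(IH jk)]; exact: Pmono.
(* If no depth is good for [g], some letter preserves this failure: otherwise the maximum of the
   finitely many depths [k_ i] would, by [PS], yield a depth for [g]. *)
have step (g : X -> X) : exists i, ~ (exists k, P g k) ->
    ~ exists k, P (g \o w i) k.
  have [?|nPg] := pselect (exists k, P g k); first by exists ord0.
  apply/not_existsP => Pi; apply: nPg.
  have /choice[k_ Pk] : forall i, exists k, P (g \o w i) k.
    by move=> i; have /not_implyP[_ /contrapT] := Pi i.
  exists (\max_i k_ i).+1; apply: PS => i.
  by apply: Pge (Pk i); exact: leq_bigmax.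
have [e eP] := choice step.
(* Following the failing letters from [id] spells an infinite word none of whose prefixes is good at
   any depth, against [Pbr]. *)
pose fix g_ k : X -> X := if k is k'.+1 then g_ k' \o w (e (g_ k')) else id.
pose alpha k := e (g_ k).
have gE k : word_map w alpha k = g_ k by elim: k => //= k ->.
have gP k : ~ exists j, P (g_ k) j by elim: k => //= k; exact: eP.
by have [k Pk] := Pbr alpha; apply: (gP k); exists 0%N; rewrite -gE.
Qed.

(** Along a single infinite word the images of [C] shrink to a point of [C], hence enter a
    neighbourhood satisfying [Q]. König's lemma makes the required length uniform over all words,
    and stability of [C] keeps longer words good. *)
Lemma small_word_images (hX : hausdorff_space X) (hw : tifs w)
    (C : compacts X) (Q : set X -> Prop) : hutchinson_set w C `<=` C ->
  (forall D D', D `<=` D' -> Q D' -> Q D) ->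
  (forall x, compacts_val C x -> exists V, [/\ open V, V x & Q V]) ->
  exists k, forall j, (k <= j)%N -> forall alpha, Q (word_map w alpha j @` C).
Proof.
move=> wC Qmono Qloc.
pose P (g : X -> X) k := forall alpha, Q ((g \o word_map w alpha k) @` C).
have PS g k : P g k -> P g k.+1.
  move=> Pgk alpha; apply: Qmono (Pgk alpha).
  move=> _ [x Cx <-]; have [|y Cy yx] := @word_map_anti alpha k C wC (word_map w alpha k.+1 x).
    by exists x.
  by exists y => //; rewrite /= yx.
have [k Pk] : exists k, P id k.
  apply: koenig => //.
  - by move=> g k Pg alpha; rewrite word_mapS compA; exact: Pg.
  - move=> alpha; have [x Cx] := hw.2 C wC alpha.
    have Cx' : compacts_val C x.
      have : [set x] x by [].
      by rewrite -Cx => /(_ 1%N isT)[y Cy <-]; exact: word_map_stable.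
    have [V [oV Vx QV]] := Qloc _ Cx'.
    have [k kV] := word_map_image_sub hX hw wC Cx oV Vx.
    by exists k => beta; exact: (Qmono _ _ kV QV).
exists k; elim=> [|j IH]; first by rewrite leqn0 => /eqP<-.
by rewrite leq_eqVlt => /orP[/eqP<-//|/IH]; exact: (PS id).
Qed.

End words.

(** * Integration against iterates of the Markov operator *)

Section markov_integral.
Local Open Scope ereal_scope.
Context (R : realType) (X : ptopologicalType) (n : nat).
Variables (w : 'I_n.+1 -> continuousType X X) (p : probVector R n.+1).
Implicit Types (mu nu : probability (borelType X) R) (F G : borelType X -> \bar R).

Lemma measurable_cts i :
  measurable_fun [set: borelType X] (w i : borelType X -> borelType X).
Proof. by apply: borel_continuous_measurable; exact: cts_fun. Qed.

Lemma ge0_integral_markov mu F : measurable_fun setT F -> (forall x, 0 <= F x) ->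
  \int[markov_fun w p mu]_x F x = \sum_i (p i)%:E * \int[mu]_x F (w i x).
Proof.
move=> mF F0.
have p0 i : (0 <= p i)%R by rewrite ltW// prob_vector_gt0.
(* [markov_fun] is presented as a finite sum of scaled push-forwards, whose integration rules are
   known; [inord] converts the natural indices of [msum]. *)
pose push i : {measure set (borelType X) -> \bar R} :=
  measure_function_pushforward__canonical__measure_function_Measure mu (measurable_cts i).
pose m_ k : {measure set (borelType X) -> \bar R} :=
  mscale (NngNum (p0 (inord k))) (push (inord k)).
rewrite (eq_measure_integral (msum m_ n.+1)); last first.
  move=> B mB _; rewrite /markov_fun /msum; apply: eq_bigr => i _.
  by rewrite /m_ /mscale/= inord_val.
rewrite ge0_integral_measure_sum//; apply: eq_bigr => i _.
rewrite ge0_integral_mscale//= inord_val; congr (_ * _).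
by rewrite ge0_integral_pushforward//; exact: measurable_cts.
Qed.

Lemma markov_measure_eq mu nu : measure_eq mu nu ->
  measure_eq (markov_fun w p mu) (markov_fun w p nu).
Proof.
move=> munu B mB; apply: eq_bigr => i _; congr (_ * _).
by apply: munu; rewrite -[X in measurable X]setTI; exact: measurable_cts.
Qed.

Section iterates.
Hypothesis hX : hausdorff_space X.
Let M := markov_operator w p hX.

(** Integrals against [iter k M mu] and [iter k M nu] are averages over words of length [k] with the
    same weights, so a bound on the sum for each word survives averaging. The induction absorbs the
    outermost map into [F] and [G]. *)
Lemma ge0_integral_iter_markov_le k (mu nu : radonProbability X R) F G b :
  measurable_fun setT F -> measurable_fun setT G ->
  (forall x, 0 <= F x) -> (forall x, 0 <= G x) ->
  (forall alpha, \int[mu]_x F (word_map w alpha k x) +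
                 \int[nu]_x G (word_map w alpha k x) <= b%:E) ->
  \int[iter k M mu]_x F x + \int[iter k M nu]_x G x <= b%:E.
Proof.
elim: k F G => [|k IH] F G mF mG F0 G0 le; first exact: le (fun=> ord0).
have iterE (m : radonProbability X R) H : \int[iter k.+1 M m]_x H x =
    \int[markov_fun w p (iter k M m)]_x H x by [].
rewrite !iterE !ge0_integral_markov// -big_split/=.
have -> : b%:E = \sum_i (p i)%:E * b%:E.
  rewrite -ge0_sume_distrl; last first.
    by move=> i _; rewrite lee_fin ltW// prob_vector_gt0.
  by rewrite sumEFin prob_vector_sum mul1e.
apply: lee_sum => i _; rewrite -ge0_muleDr ?integral_ge0//.
apply: lee_wpmul2l; first by rewrite lee_fin ltW// prob_vector_gt0.
apply: (IH (F \o w i) (G \o w i)) => //.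
- by apply: measurableT_comp mF _; exact: measurable_cts.
- by apply: measurableT_comp mG _; exact: measurable_cts.
- by move=> x; exact: F0.
- by move=> x; exact: G0.
- by move=> alpha; have := le (scons i alpha); rewrite word_map_scons.
Qed.

Lemma iter_markov_invariant k (mu : radonProbability X R) :
  invariant_measure M mu -> measure_eq (iter k M mu) mu.
Proof.
move=> Mmu; elim: k => // k IH B mB.
by rewrite -(Mmu B mB); exact: (markov_measure_eq IH).
Qed.

Lemma integral_iter_markov_invariant k (mu : radonProbability X R) F :
  invariant_measure M mu -> \int[iter k M mu]_x F x = \int[mu]_x F x.
Proof.
move=> Mmu; apply: eq_measure_integral => B mB _.
exact: iter_markov_invariant.
Qed.

End iterates.
End markov_integral.

(** * Contraction estimate, uniqueness and weak convergence *)

(** [mu] and [nu] are unrelated, so the bound is assumed at independent points [x] and [y]; this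
    lets it split into one constant for [F] and one for [G]. Mass outside [C] is charged at the
    global bound [B]. *)
Lemma integral_concentrated_le (R : realType) d (T : measurableType d)
    (mu nu : probability T R) (C : set T) (F G : T -> R) (b B : R) :
  measurable C -> C !=set0 ->
  measurable_fun setT F -> measurable_fun setT G ->
  (forall x, 0 <= F x <= B) -> (forall x, 0 <= G x <= B) ->
  (forall x y, C x -> C y -> F x + G y <= b) ->
  (\int[mu]_x (F x)%:E + \int[nu]_x (G x)%:E <=
     b%:E + B%:E * (mu (~` C) + nu (~` C)))%E.
Proof.
move=> mC [c Cc] mF mG FB GB FG.
have B0 : 0 <= B by have /andP[] := FB c; exact: le_trans.
(* [s] separates: [F <= s] and [G <= b - s] on [C]. *)
pose s := sup (F @` C).
have hsF : has_sup (F @` C).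
  split; first by exists (F c), c.
  by exists B => _ [x _ <-]; have /andP[] := FB x.
have Fs x : C x -> F x <= s by move=> Cx; apply: sup_upper_bound => //; exists x.
have sG y : C y -> G y <= b - s.
  move=> Cy; rewrite lerBrDr -lerBrDl; apply: ge_sup; first by exists (F c), c.
  by move=> _ [x Cx <-]; rewrite lerBrDr FG.
have bound (m : probability T R) (H : T -> R) (r : R) : measurable_fun setT H ->
    (forall x, 0 <= H x <= B) -> 0 <= r -> (forall x, C x -> H x <= r) ->
    (\int[m]_x (H x)%:E <= r%:E + B%:E * m (~` C))%E.
  move=> mH HB r0 Hr.
  have mi : measurable_fun setT (EFin \o (fun x => B * \1_(~` C) x)).
    apply/measurable_EFinP; apply: measurable_funM => //.
    by apply: measurable_indic; exact: measurableC.
  apply: (@le_trans _ _ (\int[m]_x (r%:E + (B * \1_(~` C) x)%:E))%E).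
    apply: ge0_le_integral => //=.
    - by move=> x _; rewrite lee_fin; have /andP[] := HB x.
    - exact/measurable_EFinP.
    - by apply: emeasurable_funD => //; exact: measurable_cst.
    - move=> x _; rewrite -EFinD lee_fin indicE in_setC.
      have [/set_mem xC|xC] := boolP (x \in C).
        by rewrite mulr0 addr0 Hr.
      by rewrite mulr1; have /andP[_ /le_trans] := HB x; apply; rewrite lerDr.
  rewrite ge0_integralD//=; [|by move=> x _; rewrite lee_fin mulr_ge0..].
  have -> : (\int[m]__ r%:E = r%:E)%E.
    by rewrite integral_cst// -[RHS]mule1; congr (_ * _)%E; exact: probability_setT.
  rewrite leeD2l//.
  under eq_integral do rewrite EFinM.
  rewrite ge0_integralZl//=; last first.
    by apply/measurable_EFinP; apply: measurable_indic; exact: measurableC.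
  by rewrite integral_indic ?setIT//; exact: measurableC.
have s0 : 0 <= s by apply: le_trans (Fs _ Cc); have /andP[] := FB c.
have bs0 : 0 <= b - s by apply: le_trans (sG _ Cc); have /andP[] := GB c.
apply: le_trans (leeD (bound mu F s mF FB s0 Fs) (bound nu G _ mG GB bs0 sG)) _.
by rewrite addeACA -EFinD [s + _]addrC subrK ge0_muleDr.
Qed.

Section contraction.
Context (R : realType) (X : ptopologicalType) (n : nat).
Hypothesis hX : hausdorff_space X.
Variables (w : 'I_n.+1 -> continuousType X X) (p : probVector R n.+1).
Hypothesis hw : tifs w.
Implicit Types mu nu : radonProbability X R.
Let M := markov_operator w p hX.

Lemma radon_tight mu (e : R) : 0 < e ->
  exists2 K : set X, compact K & (mu (~` K) <= e%:E)%E.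
Proof.
move=> e0; have mu1 : (mu [set: borelType X] = 1)%E := probability_setT _.
have := radon_inner_regular mu measurableT; rewrite mu1 => sup1.
have fin : ereal_sup [set mu K | K in [set K : set X | compact K /\ K `<=` setT]]
    \is a fin_num by rewrite -sup1.
have [_ [K [cK _] <-]] := ub_ereal_sup_adherent e0 fin.
rewrite -sup1 => lt; exists K => //.
have mK := borel_compact_measurable hX cK.
rewrite (@probability_setC _ _ _ mu K)// leeBlDr ?fin_num_measure//.
by rewrite -leeBlDl//; exact: ltW.
Qed.

Lemma stable_compact_large mu nu (e : R) : 0 < e ->
  exists C : compacts X, [/\ hutchinson_set w C `<=` C,
    (mu (~` C) <= e%:E)%E & (nu (~` C) <= e%:E)%E].
Proof.
move=> e0; have [K cK Ke] := radon_tight mu e0.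
have [L cL Le] := radon_tight nu e0.
(* Adding [point] keeps the union nonempty even when [K] and [L] are both empty. *)
pose D : compacts X := @Compacts X (K `|` L `|` [set point])
  (compactU (compactU cK cL) (@compact_set1 _ point))
  (ex_intro _ (point : X) (or_intror erefl)).
have [C [DC wC]] := hw.1 D.
have mC := borel_compact_measurable hX (@compacts_compact _ C).
exists C; split => //.
- apply: le_trans Ke; apply: le_measure; rewrite ?inE; [exact: measurableC| |].
    by apply: measurableC; exact: borel_compact_measurable.
  by apply: subsetC => x Kx; apply: DC; left; left.
- apply: le_trans Le; apply: le_measure; rewrite ?inE; [exact: measurableC| |].
    by apply: measurableC; exact: borel_compact_measurable.
  by apply: subsetC => x Lx; apply: DC; left; right.
Qed.

(** Up to a small mass both measures live on one stable compact [C], and long words send all of [C]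
    into sets where the local bound on [F y + G z] holds. The escaping mass accounts for [e]. *)
Lemma iter_markov_concentration mu nu (F G : borelType X -> R) (b B e : R) :
  measurable_fun setT F -> measurable_fun setT G ->
  (forall x, 0 <= F x <= B) -> (forall x, 0 <= G x <= B) ->
  (forall x, exists V : set X, [/\ open V, V x &
     forall y z, V y -> V z -> F y + G z <= b]) ->
  0 < e ->
  exists k0, forall k, (k0 <= k)%N ->
    (\int[iter k M mu]_x (F x)%:E + \int[iter k M nu]_x (G x)%:E <=
     (b + e)%:E)%E.
Proof.
move=> mF mG FB GB loc e0.
have B0 : 0 <= B by have /andP[] := FB point; exact: le_trans.
have B1 : 0 < B + 1 by rewrite ltr_wpDl.
(* Each measure loses at most [dl], at a total cost [B * (dl + dl) <= e]; the denominator is [B + 1]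
   because [B] may vanish. *)
pose dl := e / (B + 1) / 2.
have d0 : 0 < dl by rewrite !divr_gt0.
have [C [wC muC nuC]] := stable_compact_large mu nu d0.
have mC := borel_compact_measurable hX (@compacts_compact _ C).
have [||k0 k0P] := @small_word_images X n w hX hw C
    (fun D => forall y z, D y -> D z -> F y + G z <= b) wC.
- by move=> D D' DD' D'P y z /DD' + /DD'; exact: D'P.
- by move=> x _; exact: loc.
exists k0 => k k0k.
apply: (@ge0_integral_iter_markov_le R X n w p hX k mu nu
  (EFin \o F) (EFin \o G)).
- exact/measurable_EFinP.
- exact/measurable_EFinP.
- by move=> x /=; rewrite lee_fin; have /andP[] := FB x.
- by move=> x /=; rewrite lee_fin; have /andP[] := GB x.
move=> alpha /=.
have mword : measurable_fun [set: borelType X]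
    (word_map w alpha k : borelType X -> borelType X).
  by apply: borel_continuous_measurable; exact: word_map_continuous.
apply: le_trans (@integral_concentrated_le R _ (borelType X) mu nu C
  (F \o word_map w alpha k) (G \o word_map w alpha k) b B _ _ _ _ _ _ _) _ => //.
- exact: compacts_nonempty.
- exact: measurableT_comp mF mword.
- exact: measurableT_comp mG mword.
- by move=> x; exact: FB.
- by move=> x; exact: GB.
- by move=> x y Cx Cy; apply: (k0P k k0k alpha); [exists x|exists y].
rewrite EFinD leeD2l//; apply: (@le_trans _ _ (B%:E * (dl%:E + dl%:E))%E).
  by apply: lee_wpmul2l => //; exact: leeD.
rewrite -EFinD -EFinM lee_fin /dl -splitr mulrA ler_pdivrMr//.
by rewrite mulrC ler_wpM2l ?lerDl// ltW.
Qed.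

(** Every point has a neighbourhood missing [K] or missing [L], so the two indicators satisfy the
    local bound [1]; invariance then removes the iterates. *)
Lemma invariant_disjoint_compact mu nu (K L : set X) :
  invariant_measure M mu -> invariant_measure M nu ->
  compact K -> compact L -> K `&` L = set0 -> (mu K + nu L <= 1)%E.
Proof.
move=> Mmu Mnu cK cL KL0.
have mK := borel_compact_measurable hX cK.
have mL := borel_compact_measurable hX cL.
apply/lee_addgt0Pr => e e0.
have ind01 (D : set (borelType X)) x : 0 <= (\1_D x : R) <= 1.
  by rewrite indicE; case: (_ \in _); rewrite ?lexx ler01.
have [|||k /(_ k (leqnn k))] :=
  @iter_markov_concentration mu nu \1_K \1_L 1 1 e _ _ (ind01 _) (ind01 _) _ e0.
- exact: measurable_indic.
- exact: measurable_indic.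
- move=> x; have [Kx|nKx] := pselect (K x).
    exists (~` L); split.
    + by apply: closed_openC; exact: compact_closed.
    + by move=> Lx; have : (K `&` L) x by []; rewrite KL0.
    move=> y z _ nLz; rewrite [\1_L z]indicE memNset// addr0.
    by have /andP[] := ind01 K y.
  exists (~` K); split => //.
  + by apply: closed_openC; exact: compact_closed.
  move=> y z nKy _; rewrite [\1_K y]indicE memNset// add0r.
  by have /andP[] := ind01 L z.
rewrite !integral_iter_markov_invariant// !integral_indic// !setIT.
by rewrite EFinD.
Qed.

(** Compact sets [L] in the complement of [K] satisfy [m2 L <= 1 - m1 K]; inner regularity of [m2]
    on that complement gives [m1 K <= m2 K]. Inner regularity of [m1] extends this to Borel sets,
    and symmetry concludes. *)
Lemma invariant_measure_unique mu nu :
  invariant_measure M mu -> invariant_measure M nu -> measure_eq mu nu.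
Proof.
move=> Mmu Mnu.
have leK (m1 m2 : radonProbability X R) (K : set X) : invariant_measure M m1 ->
    invariant_measure M m2 -> compact K -> (m1 K <= m2 K)%E.
  move=> Mm1 Mm2 cK; have mK := borel_compact_measurable hX cK.
  have fin2 : m2 K \is a fin_num by exact: fin_num_measure.
  have fin1 : m1 K \is a fin_num by exact: fin_num_measure.
  have : (m2 (~` K) <= 1 - m1 K)%E.
    rewrite (radon_inner_regular m2 (measurableC mK)).
    apply: ge_ereal_sup => _ [L [cL LK] <-].
    rewrite leeBrDl//; apply: invariant_disjoint_compact => //.
    by rewrite setIC; apply/disjoints_subset.
  rewrite (@probability_setC _ _ _ m2 K)// -(fineK fin1) -(fineK fin2).
  by rewrite -!EFinB !lee_fin lerD2l lerN2.
have le (m1 m2 : radonProbability X R) (B : set (borelType X)) :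
    invariant_measure M m1 -> invariant_measure M m2 -> measurable B ->
    (m1 B <= m2 B)%E.
  move=> Mm1 Mm2 mB; rewrite (radon_inner_regular m1 mB).
  apply: ge_ereal_sup => _ [K [cK KB] <-].
  apply: le_trans (leK _ _ _ Mm1 Mm2 cK) _.
  by apply: le_measure; rewrite ?inE//; exact: borel_compact_measurable.
by move=> B mB; apply/eqP; rewrite eq_le !le.
Qed.

Lemma weakly_converges_iter_markov mu mu_star :
  invariant_measure M mu_star ->
  weakly_converges (fun k => iter k M mu) mu_star.
Proof.
move=> Mmu f cf bf.
have [B B0 fB] : exists2 B, 0 < B & forall x, `|f x| <= B.
  have [B [_ fB]] := bf; exists (`|B| + 1); first by rewrite ltr_wpDl.
  by move=> x; apply: fB => //; rewrite (le_lt_trans (ler_norm _))// ltrDl.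
have mf : measurable_fun [set: borelType X] f.
  apply: (@measurability _ _ (borelType X) R setT f _ (RGenOpens.measurableE R)).
  move=> _ [_ [a [b ->]] <-]; rewrite setTI; apply: sub_sigma_algebra.
  by move/continuousP : cf; apply; exact: interval_open.
have intf (m : radonProbability X R) : m.-integrable setT (EFin \o f).
  apply: measurable_bounded_integrable => //.
  by rewrite (le_lt_trans (probability_le1 _ _))// ltry.
have intB (m : radonProbability X R) : m.-integrable setT (EFin \o cst B).
  exact: finite_measure_integrable_cst.
have RB (m : radonProbability X R) : \int[m]_x B = B.
  rewrite Rintegral_cst// -[RHS]mulr1; congr (_ * _).
  by rewrite -[RHS]/(fine 1%E); congr fine; exact: probability_setT.
pose F x := f x + B.
pose G x := B - f x.
have FE (m : radonProbability X R) :
    (\int[m]_x (F x)%:E = (\int[m]_x f x + B)%:E)%E.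
  rewrite -[in RHS](RB m) -(RintegralD measurableT (intf m) (intB m)) /Rintegral fineK//.
  by apply: integrable_fin_num => //; exact: (integrableD _ (intf m) (intB m)).
have GE (m : radonProbability X R) :
    (\int[m]_x (G x)%:E = (B - \int[m]_x f x)%:E)%E.
  rewrite -[in RHS](RB m) -(RintegralB measurableT (intB m) (intf m)) /Rintegral fineK//.
  by apply: integrable_fin_num => //; exact: (integrableB _ (intB m) (intf m)).
have mF : measurable_fun [set: borelType X] F by exact: measurable_funD.
have mG : measurable_fun [set: borelType X] G by exact: measurable_funB.
have FB x : 0 <= F x <= B + B.
  by have := fB x; rewrite ler_norml /F => /andP[? ?]; apply/andP; split; lra.
have GB x : 0 <= G x <= B + B.
  by have := fB x; rewrite ler_norml /G => /andP[? ?]; apply/andP; split; lra.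
have loc (e : R) : 0 < e -> forall x, exists V : set X, [/\ open V, V x &
    forall y z, V y -> V z -> F y + G z <= B + B + e].
  move=> e0 x; exists (f @^-1` ball (f x) (e / 2)); split.
  - by move/continuousP : cf; apply; exact: ball_open.
  - by apply: ballxx; exact: divr_gt0.
  move=> y z; rewrite /ball/= !ltr_norml /F /G => /andP[? ?] /andP[? ?]; lra.
apply/cvgrPdist_le => e e0.
have e2 : 0 < e / 2 by exact: divr_gt0.
(* Half of [e] pays for the oscillation of [f], half for escaping mass. The first call bounds the
   difference of integrals from above, the second, with the measures exchanged, from below. *)
have [k1 k1P] := iter_markov_concentration mu mu_star mF mG FB GB (loc _ e2) e2.
have [k2 k2P] := iter_markov_concentration mu_star mu mF mG FB GB (loc _ e2) e2.
exists (maxn k1 k2) => // k /=; rewrite geq_max => /andP[/k1P + /k2P].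
rewrite !FE !GE -!EFinD !lee_fin.
have -> : \int[iter k M mu_star]_x f x = \int[mu_star]_x f x.
  by rewrite /Rintegral integral_iter_markov_invariant.
rewrite ler_norml => ? ?; apply/andP; split; lra.
Qed.

End contraction.

(** * Digit expansion of [[0, 1[] attached to the weights *)

Section subdivision.
Context (R : realType) (n : nat).
Variable p : probVector R n.+1.

(** Indexed by naturals so that the right end of the last cell, [partial_mass n.+1], makes sense. *)
Definition partial_mass k : R := \sum_(0 <= j < k) p (inord j).

Lemma partial_mass0 : partial_mass 0 = 0.
Proof. by rewrite /partial_mass big_nil. Qed.

Lemma partial_massS (i : 'I_n.+1) : partial_mass i.+1 = partial_mass i + p i.
Proof. by rewrite /partial_mass big_nat_recr//= inord_val. Qed.

Lemma partial_mass_le j k : (j <= k)%N -> partial_mass j <= partial_mass k.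
Proof.
move=> jk; rewrite /partial_mass (@big_cat_nat _ _ _ j 0 k)//= lerDl.
by apply: sumr_ge0 => i _; rewrite ltW// prob_vector_gt0.
Qed.

Lemma partial_mass_ge0 k : 0 <= partial_mass k.
Proof. by rewrite -partial_mass0 partial_mass_le. Qed.

Lemma partial_mass1 : partial_mass n.+1 = 1.
Proof.
rewrite /partial_mass big_mkord -(prob_vector_sum p).
by apply: eq_bigr => i _; rewrite inord_val.
Qed.

Definition cell (i : 'I_n.+1) : set R :=
  [set` `[partial_mass i, partial_mass i.+1[].

Lemma cell_uniq i j x : cell i x -> cell j x -> i = j.
Proof.
rewrite /cell/= !in_itv/= => /andP[ix xi] /andP[jx xj].
case: (ltngtP i j) => [/partial_mass_le ij|/partial_mass_le ij|/val_inj//].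
  by have := le_lt_trans (le_trans ij jx) xi; rewrite ltxx.
by have := le_lt_trans (le_trans ij ix) xj; rewrite ltxx.
Qed.

Lemma cell_cover : [set` `[0, 1[] = \bigcup_i cell i.
Proof.
apply/seteqP; split=> x /=; rewrite in_itv/=; last first.
  move=> [i _]; rewrite /cell/= in_itv/= => /andP[ix xi]; apply/andP; split.
    by rewrite (le_trans _ ix)// partial_mass_ge0.
  by rewrite (lt_le_trans xi)// -partial_mass1 partial_mass_le.
rewrite -partial_mass1 => /andP[x0].
suff : forall k, (k <= n.+1)%N -> x < partial_mass k -> exists i, cell i x.
  by move=> /(_ n.+1 (leqnn _)) /[apply] -[i]; exists i.
elim=> [_|k IH kn xk]; first by rewrite partial_mass0 ltNge x0.
have [xk'|kx] := ltP x (partial_mass k); first exact: (IH (ltnW kn)).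
by exists (Ordinal kn); rewrite /cell/= in_itv/= kx.
Qed.

Definition branch (i : 'I_n.+1) (y : R) : R := partial_mass i + p i * y.

Lemma branch_cell i : branch i @^-1` cell i = [set` `[0, 1[].
Proof.
have p0 := prob_vector_gt0 p i.
apply/seteqP; split=> y; rewrite /cell /branch/= !in_itv/= partial_massS.
  by rewrite lerDl pmulr_rge0// ltrD2l gtr_pMr.
by rewrite lerDl pmulr_rge0// ltrD2l gtr_pMr.
Qed.

Lemma measurable_branch i : measurable_fun [set: R] (branch i).
Proof. by apply: measurable_funD => //; exact: measurable_funM. Qed.

Definition digit (x : R) : 'I_n.+1 := xget ord0 [set i | cell i x].

Lemma digitE i x : cell i x -> digit x = i.
Proof.
by move=> ix; apply: xget_unique => // j jx; exact: (cell_uniq jx ix).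
Qed.

(** The full-branch piecewise affine expanding map, acting as the shift on digits; for equal weights
    it is multiplication by [n.+1] modulo [1] on [[0, 1[]. *)
Definition rescale (x : R) : R := (x - partial_mass (digit x)) / p (digit x).

Lemma branchK i y : 0 <= y < 1 -> digit (branch i y) = i /\ rescale (branch i y) = y.
Proof.
move=> y01; have di : digit (branch i y) = i.
  apply: digitE; rewrite -[cell i _]/((branch i @^-1` cell i) y) branch_cell.
  by rewrite /= in_itv.
split => //; rewrite /rescale di /branch addrC addKr mulrC mulKf//.
by rewrite gt_eqF// prob_vector_gt0.
Qed.

Lemma rescaleK x : branch (digit x) (rescale x) = x.
Proof.
rewrite /branch /rescale mulrC divfK; first by rewrite addrC subrK.
by rewrite gt_eqF// prob_vector_gt0.
Qed.

Lemma rescale01 x : 0 <= x < 1 -> 0 <= rescale x < 1.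
Proof.
move=> x01; have : [set` `[0, 1[] x by rewrite /= in_itv.
rewrite cell_cover => -[i _ ix].
suff : [set` `[0, 1[] (rescale x) by rewrite /= in_itv.
by rewrite -(branch_cell i) /= -{2}(digitE ix) rescaleK.
Qed.

Definition digits (x : R) : nat -> 'I_n.+1 := fun k => digit (iter k rescale x).

Lemma digits_scons x : digits x = scons (digit x) (digits (rescale x)).
Proof. by apply/funext => -[//|k]; rewrite /digits iterSr. Qed.

Lemma digits_branch i y : 0 <= y < 1 -> digits (branch i y) = scons i (digits y).
Proof. by move=> y01; rewrite digits_scons; have [-> ->] := branchK i y01. Qed.

(** Affine change of variables, from uniqueness of Lebesgue measure: the push-forward by the branch,
    scaled by [p i], gives half-open intervals their length. *)
Lemma lebesgue_branch i (E : set R) : measurable E ->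
  (lebesgue_measure E = (p i)%:E * lebesgue_measure (branch i @^-1` E))%E.
Proof.
have p0 := prob_vector_gt0 p i.
pose push : {measure set (measurableTypeR R) -> \bar R} :=
  measure_function_pushforward__canonical__measure_function_Measure
    (@lebesgue_measure R) (measurable_branch i :
      measurable_fun [set: measurableTypeR R] (branch i : _ -> measurableTypeR R)).
pose m : {measure set (measurableTypeR R) -> \bar R} :=
  mscale (NngNum (ltW p0)) push.
move=> mE; rewrite (@lebesgue_measure_unique R m)// => _ [[a b] _ <-].
rewrite /m /mscale/= /pushforward.
pose J : set R := `](a - partial_mass i) / p i, (b - partial_mass i) / p i]%classic.
transitivity ((p i)%:E * lebesgue_measure J)%E; last first.
  congr (_ * lebesgue_measure _)%E; apply/seteqP; split=> y;
    by rewrite /J/= !in_itv/= /branch ltr_pdivrMr// ler_pdivlMr// ltrBlDl lerBrDl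
               [y * _]mulrC.
rewrite /J !lebesgue_measure_itv/= !lte_fin ltr_pM2r ?invr_gt0// ltrD2r.
case: ifPn => _; last by rewrite mule0.
rewrite -!EFinD -EFinM; congr EFin.
by rewrite -mulrBl mulrC divfK ?gt_eqF//; ring.
Qed.

(** Cutting [E] along the cells reduces to one branch at a time. Thus Lebesgue measure on [[0, 1[]
    is invariant for the branches with weights [p], the model of the invariance sought on [X]. *)
Lemma lebesgue_self_similar (E : set R) : measurable E ->
  (lebesgue_measure (E `&` `[0%R, 1%R[) =
   \sum_i (p i)%:E * lebesgue_measure (branch i @^-1` E `&` `[0%R, 1%R[))%E.
Proof.
move=> mE.
have mEc i : measurable (E `&` cell i) by apply: measurableI => //; exact: measurable_itv.
have -> : E `&` `[0, 1[%classic =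
    \big[setU/set0]_(i < n.+1) (E `&` cell i).
  rewrite -big_distrr/= -bigcup_mkord_ord cell_cover; congr (_ `&` _).
  apply/seteqP; split=> x [i _ ix]; first by exists (val i); rewrite //= inord_val.
  by exists (inord i).
transitivity (\sum_(i < n.+1) lebesgue_measure (E `&` cell i))%E.
  apply: measure_bigsetU_ord => //.
  apply/trivIsetP => i j _ _ ij; apply/seteqP; split => // x [[_ ix] [_ jx]].
  by move/eqP : ij; apply; exact: (cell_uniq ix jx).
apply: eq_bigr => i _; rewrite (lebesgue_branch i (mEc i)); congr (_ * lebesgue_measure _)%E.
by rewrite preimage_setI branch_cell.
Qed.

Lemma cell_affineE i x : cell i x -> rescale x = (x - partial_mass i) / p i.
Proof. by rewrite /rescale => /digitE->. Qed.

Lemma cell01 i x : cell i x -> 0 <= x < 1.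
Proof.
move=> ix; have : [set` `[0, 1[] x by rewrite cell_cover; exists i.
by rewrite /= in_itv.
Qed.

(** [E] depends on the digit so that a condition on the first digit and the remainder can be treated
    jointly; on each cell [rescale] is affine. *)
Lemma measurable_rescale (E : 'I_n.+1 -> set R) :
  (forall i, measurable (E i `&` `[0, 1[%classic)) ->
  measurable ([set x | E (digit x) (rescale x)] `&` `[0, 1[%classic).
Proof.
move=> mE; pose h (i : 'I_n.+1) x := (x - partial_mass i) / p i.
have -> : [set x | E (digit x) (rescale x)] `&` `[0, 1[%classic =
    \bigcup_i (cell i `&` h i @^-1` (E i `&` `[0, 1[%classic)).
  apply/seteqP; split=> [x [Ex]|x [i _ [ix [Ex _]]]].
    rewrite {1}cell_cover => -[i _ ix]; exists i => //; split => //.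
    rewrite /h /= -(cell_affineE ix) -{1}(digitE ix); split => //.
    by rewrite /= in_itv/= rescale01// (cell01 ix).
  split; last by rewrite cell_cover; exists i.
  by rewrite /= (digitE ix) (cell_affineE ix).
apply: fin_bigcup_measurable => // i _.
apply: measurableI; first exact: measurable_itv.
rewrite -[X in measurable X]setTI.
have mh : measurable_fun [set: R] (h i).
  by apply: measurable_funM => //; exact: measurable_funB.
exact: (mh measurableT _ (mE i)).
Qed.

(** [Q] depends only on the first [k] letters: the first one becomes the index in
    [measurable_rescale], the others go to the induction. *)
Lemma measurable_digits k (Q : (nat -> 'I_n.+1) -> Prop) :
  (forall a b, (forall j, (j < k)%N -> a j = b j) -> Q a -> Q b) ->
  measurable ([set x | Q (digits x)] `&` `[0, 1[%classic).
Proof.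
elim: k Q => [|k IH] Q QE.
  have [Q0|nQ0] := pselect (Q (digits 0)).
    rewrite (_ : [set x | _] = setT) ?setTI//.
    by apply/seteqP; split => // x _; apply: QE Q0.
  rewrite (_ : [set x | _] = set0) ?set0I//.
  by apply/seteqP; split => // x Qx; apply: nQ0; apply: QE Qx.
under eq_set do rewrite digits_scons.
apply: (@measurable_rescale (fun i => [set y | Q (scons i (digits y))])) => i.
by apply: (IH (Q \o scons i)) => a b ab /=; apply: QE => -[//|j]; exact: ab.
Qed.

(** Within [[0, 1[], every branch pulls the preimage under [rescale] back to [E] itself, and the
    weights sum to [1]. *)
Lemma lebesgue_rescale (E : set R) : measurable (E `&` `[0, 1[%classic) ->
  lebesgue_measure (rescale @^-1` E `&` `[0, 1[%classic) =
  lebesgue_measure (E `&` `[0, 1[%classic).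
Proof.
move=> mE.
have mE' : measurable (rescale @^-1` E `&` `[0, 1[%classic).
  exact: (@measurable_rescale (fun=> E)).
have -> : rescale @^-1` E `&` `[0, 1[%classic =
    (rescale @^-1` E `&` `[0, 1[%classic) `&` `[0, 1[%classic.
  by rewrite -setIA setIid.
rewrite lebesgue_self_similar//.
under eq_bigr => i _.
  have -> : branch i @^-1` (rescale @^-1` E `&` `[0, 1[%classic) `&` `[0, 1[%classic
     = E `&` `[0, 1[%classic.
    apply/seteqP; split=> y [].
      move=> [/= Ey _] y01; split => //; move: y01 Ey; rewrite /= in_itv/= => y01.
      by have [_ ->] := branchK i y01.
    move=> Ey /[dup] y01' /=; rewrite in_itv/= => y01.
    split; last exact: y01'.
    split=> /=; first by have [_ ->] := branchK i y01.
    have : (branch i @^-1` cell i) y by rewrite branch_cell.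
    by move=> /cell01; rewrite in_itv.
  over.
rewrite -ge0_sume_distrl; last by move=> i _; rewrite lee_fin ltW// prob_vector_gt0.
by rewrite sumEFin prob_vector_sum mul1e.
Qed.

(* [rescale x = 0] exactly when [x] is the left endpoint of a cell, where the
   digits jump; away from [bad] every digit is locally constant. *)
Definition bad : set R :=
  \bigcup_k ([set x | iter k.+1 rescale x = 0] `&` `[0, 1[%classic).

(** Since [rescale] preserves Lebesgue measure, each set in the countable union has the measure of a
    single point. *)
Lemma bad_null : measurable bad /\ lebesgue_measure bad = 0%E.
Proof.
have bad_k k :
    measurable ([set x | iter k rescale x = 0] `&` `[0, 1[%classic) /\
    lebesgue_measure ([set x | iter k rescale x = 0] `&` `[0, 1[%classic) = 0%E.
  elim: k => [|k [mk lk]].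
    have -> : [set x | iter 0 rescale x = 0] `&` `[0, 1[%classic = [set 0].
      apply/seteqP; split=> [x []//|_ ->].
      by split => //=; rewrite in_itv/= lexx ltr01.
    by split; [exact: measurable_set1|exact: lebesgue_measure_set1].
  have -> : [set x | iter k.+1 rescale x = 0] =
      rescale @^-1` [set x | iter k rescale x = 0].
    by apply/seteqP; split=> x /=; rewrite -iterS iterSr.
  by split; [exact: (@measurable_rescale (fun=> _))|rewrite lebesgue_rescale].
have mbad : measurable bad by apply: bigcup_measurable => k _; have [] := bad_k k.+1.
split => //; apply: measure_negligible => //.
apply: negligible_bigcup => k; have [mk lk] := bad_k k.+1.
by apply/negligibleP.
Qed.

(** As [rescale x] is nonzero, [x] is interior to its cell, where the digit is constant and
    [rescale] is affine; continuity brings the induction hypothesis at [rescale x] back to [x]. *)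
Lemma near_digits k x : 0 <= x < 1 ->
  (forall j, (j < k)%N -> iter j.+1 rescale x != 0) ->
  \forall y \near x, forall j, (j < k)%N -> digits y j = digits x j.
Proof.
elim: k x => [|k IH] x x01 x0; first by near=> y.
have := x01; rewrite -[_ <= _ < _]/(x \in `[0, 1[) => x01'.
have : [set` `[0, 1[] x by [].
rewrite cell_cover => -[i _ ix].
have Tx0 : rescale x != 0 by exact: (x0 0%N).
have xo : x \in `]partial_mass i, partial_mass i.+1[.
  move: (ix); rewrite /cell/= !in_itv/= => /andP[lx ->]; rewrite andbT.
  rewrite lt_neqAle lx andbT eq_sym; apply: contra Tx0 => /eqP xE.
  by rewrite (cell_affineE ix) {1}xE subrr mul0r.
pose h y := (y - partial_mass i) / p i.
have ch : h @ x --> h x.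
  by apply: cvgMl; apply: cvgB; [exact: cvg_id|exact: cvg_cst].
have hx : h x = rescale x by rewrite (cell_affineE ix).
have near_h : \forall y \near x, forall j, (j < k)%N ->
    digits (h y) j = digits (rescale x) j.
  have IHx : \forall z \near h x, forall j, (j < k)%N ->
      digits z j = digits (rescale x) j.
    rewrite hx; apply: IH; first exact: rescale01.
    by move=> j jk; rewrite -iterSr; exact: x0.
  exact: ch IHx.
near=> y.
have iy : cell i y.
  have : y \in `]partial_mass i, partial_mass i.+1[.
    by near: y; exact: near_in_itvoo.
  by rewrite /cell/= !in_itv/= => /andP[/ltW-> ->].
case=> [_|j jk].
  by rewrite /digits/= (digitE ix) (digitE iy).
rewrite /digits !iterSr -!/(digits _ _) (cell_affineE iy) -/(h y).
by move: j jk; near: y.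
Unshelve. all: by end_near. Qed.

End subdivision.

(** * Lebesgue measure on [[0, 1[] as a probability on the line *)

Section unit_lebesgue.
Context (R : realType).

Definition unit_lebesgue : set (measurableTypeR R) -> \bar R :=
  mrestr (@lebesgue_measure R) (measurable_itv `[0, 1[ : measurable (_ : set (measurableTypeR R))).

HB.instance Definition _ := Measure.on unit_lebesgue.

Let unit_lebesgue_setT : unit_lebesgue setT = 1%E.
Proof.
rewrite /unit_lebesgue /mrestr setTI lebesgue_measure_itv/= lte_fin ltr01.
by rewrite oppr0 adde0.
Qed.

HB.instance Definition _ :=
  @Measure_isProbability.Build _ _ R unit_lebesgue unit_lebesgue_setT.

End unit_lebesgue.

(** * Coding of the attractor by infinite words *)

Section coding.
Context (X : topologicalType) (n : nat).
Hypothesis hX : hausdorff_space X.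
Variables (w : 'I_n.+1 -> continuousType X X).
Hypothesis hw : tifs w.
Variable A : compacts X.
Hypothesis wA : hutchinson_set w A = A.
Variable pt : (nat -> 'I_n.+1) -> X.
Hypothesis ptP : forall alpha,
  \bigcap_(k in [set k | (0 < k)%N]) (word_map w alpha k @` A) = [set pt alpha].

Let stableA : hutchinson_set w A `<=` A. Proof. by rewrite wA. Qed.

Lemma coding_in alpha : compacts_val A (pt alpha).
Proof.
have : [set pt alpha] (pt alpha) by [].
by rewrite -ptP => /(_ 1%N isT)[y Ay <-]; exact: word_map_stable.
Qed.

Lemma coding_word alpha k : (word_map w alpha k @` A) (pt alpha).
Proof.
(* [ptP] covers positive lengths only; at length [0] the image is [A]. *)
case: k => [|k]; first by exists (pt alpha) => //; exact: coding_in.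
have : [set pt alpha] (pt alpha) by [].
by rewrite -ptP => /(_ k.+1 isT).
Qed.

Lemma coding_scons i alpha : pt (scons i alpha) = w i (pt alpha).
Proof.
suff : [set pt (scons i alpha)] (w i (pt alpha)) by [].
rewrite -ptP => -[//|k] _; have [y Ay yE] := coding_word alpha k.
by exists y => //; rewrite word_map_scons/= yE.
Qed.

Lemma coding_nbhs alpha (V : set X) : open V -> V (pt alpha) ->
  exists k, word_map w alpha k @` A `<=` V.
Proof. exact: word_map_image_sub. Qed.

(** Each point of [A] has a preimage in [A] under some [w i], by [wA]; iterating backwards from [x]
    spells a word whose images of [A] all contain [x]. *)
Lemma coding_onto x : compacts_val A x -> exists alpha, pt alpha = x.
Proof.
move=> Ax.
have step (y : X) : exists iz : 'I_n.+1 * X,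
    compacts_val A y -> compacts_val A iz.2 /\ w iz.1 iz.2 = y.
  have [|?] := pselect (compacts_val A y); last by exists (ord0, y).
  by rewrite -{1}wA => -[i _ [z Az zy]]; exists (i, z).
have [g gP] := choice step.
pose y_ k := iter k (fun y => (g y).2) x.
pose alpha k := (g (y_ k)).1.
have Ay k : compacts_val A (y_ k).
  by elim: k => // k /gP[].
have xE k : word_map w alpha k (y_ k) = x.
  by elim: k => //= k <-; congr word_map; have [_] := gP _ (Ay k).
exists alpha; suff : [set pt alpha] x by [].
by rewrite -ptP => k _; exists (y_ k).
Qed.

End coding.

(** * Existence of an invariant Radon measure *)

Section invariant.
Context (R : realType) (X : ptopologicalType) (n : nat).
Hypothesis hX : hausdorff_space X.
Variables (w : 'I_n.+1 -> continuousType X X) (p : probVector R n.+1).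
Hypothesis hw : tifs w.
Variable A : compacts X.
Hypothesis wA : hutchinson_set w A = A.
Variable pt : (nat -> 'I_n.+1) -> X.
Hypothesis ptP : forall alpha,
  \bigcap_(k in [set k | (0 < k)%N]) (word_map w alpha k @` A) = [set pt alpha].

(* Points outside [[0, 1[] are given the digits of [0]. *)
Definition coded (x : R) : X := pt (digits p (if x \in `[0, 1[ then x else 0)).

Lemma codedE (E : set X) :
  coded @^-1` E `&` `[0, 1[%classic = [set x | E (pt (digits p x))] `&` `[0, 1[%classic.
Proof.
by apply/seteqP; split=> x [Ex /= x01]; split => //; move: Ex;
  rewrite /coded/= x01.
Qed.

Lemma coded_branch i x : x \in `[0, 1[ -> coded (branch p i x) = w i (coded x).
Proof.
move=> x01; have bx01 : branch p i x \in `[0, 1[.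
  suff : (`[0, 1[%classic : set R) (branch p i x) by [].
  rewrite (cell_cover p); exists i => //.
  have xI : (`[0, 1[%classic : set R) x := x01.
  by move: xI; rewrite -(branch_cell p i).
rewrite /coded x01 bx01 digits_branch; last by move: x01; rewrite in_itv.
exact: (coding_scons wA ptP).
Qed.

(** A coded point lies in an open [V] exactly when some finite prefix of its word maps [A] into [V]:
    on [[0, 1[] this is a countable union of conditions on finitely many digits, and elsewhere
    [coded] is constant. *)
Lemma measurable_coded :
  measurable_fun [set: measurableTypeR R] (coded : _ -> borelType X).
Proof.
apply: (@measurability _ _ _ (borelType X) setT _ (@open X) erefl).
move=> _ [V oV <-]; rewrite setTI.
have mI : measurable (`[0, 1[%classic : set (measurableTypeR R)).
  exact: measurable_itv.
have -> : coded @^-1` V = (coded @^-1` V `&` `[0, 1[%classic) `|`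
    (coded @^-1` V `&` ~` `[0, 1[%classic) by rewrite -setIUr setUv setIT.
apply: measurableU.
  rewrite codedE.
  have -> : [set x | V (pt (digits p x))] `&` `[0, 1[%classic =
      \bigcup_k ([set x | word_map w (digits p x) k @` A `<=` V] `&` `[0, 1[%classic).
    apply/seteqP; split=> x.
      move=> [/= Vx x01].
      by have [k kV] := coding_nbhs hX hw wA ptP oV Vx; exists k.
    move=> [k _ [/= kV x01]]; split => //=; apply: kV.
    exact: (coding_word wA ptP).
  apply: bigcup_measurable => k _.
  apply: (@measurable_digits R n p k
    (fun alpha => word_map w alpha k @` A `<=` V)) => a b ab.
  by rewrite (eq_word_map _ ab).
have [V0|nV0] := pselect (V (pt (digits p 0))).
  rewrite (_ : _ `&` _ = ~` `[0, 1[%classic); first exact: measurableC.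
  apply/seteqP; split=> [x []//|x x01]; split => //.
  by rewrite /coded/= ifN//; apply/negP.
rewrite (_ : _ `&` _ = set0)//.
apply/seteqP; split=> // x [+ /negP x01].
by rewrite /coded/= ifN.
Qed.

(** Off [bad] the first [k] digits are locally constant, and for large [k] they confine the coded
    point to the given neighbourhood. *)
Lemma coded_continuous (K : set R) : K `<=` `[0, 1[%classic `\` bad p ->
  {within K, continuous coded}.
Proof.
move=> Kgood; apply/subspace_continuousP => x Kx U.
rewrite nbhsE => -[V [oV Vx] VU].
have [x01 xgood] := Kgood _ Kx.
have codedx y : y \in `[0, 1[ -> coded y = pt (digits p y) by rewrite /coded => ->.
have {}Vx : V (pt (digits p x)) by rewrite -codedx.
have [k kV] := coding_nbhs hX hw wA ptP oV Vx.
have near_x : \forall y \near x, forall j, (j < k)%N -> digits p y j = digits p x j.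
  apply: near_digits; first by move: x01; rewrite /= in_itv.
  by move=> j jk; apply/eqP => xj; apply: xgood; exists j.
change (\forall y \near x, K y -> U (coded y)).
apply: filterS near_x => y yx Ky; apply: VU.
rewrite codedx; last by have [] := Kgood _ Ky.
apply: kV; rewrite -(eq_word_map w yx); exact: (coding_word wA ptP).
Qed.

(** Inner regularity of Lebesgue measure gives a compact [K] nearly filling the preimage of [B]
    minus the null set [bad]; [coded] is continuous on [K], so its image is a compact subset of [B]
    of nearly full mass. *)
Lemma coded_radon : exists mu : radonProbability X R,
  forall B : set (borelType X),
    mu B = lebesgue_measure (coded @^-1` B `&` `[0, 1[%classic).
Proof.
pose f : {mfun measurableTypeR R >-> borelType X} :=
  HB.pack (coded : measurableTypeR R -> borelType X)
    (isMeasurableFun.Build _ _ _ _ _ measurable_coded).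
pose P : probability (borelType X) R := distribution (@unit_lebesgue R) f.
have PE (B : set (borelType X)) :
    P B = lebesgue_measure (coded @^-1` B `&` `[0, 1[%classic) by [].
suff rP : inner_regular P by exists (RadonProbability rP).
move=> B mB; apply/eqP; rewrite eq_le; apply/andP; split; last first.
  apply: ge_ereal_sup => _ [K [cK KB] <-]; apply: le_measure => //; rewrite inE//.
  exact: borel_compact_measurable.
apply/lee_addgt0Pr => e e0.
pose E : set (measurableTypeR R) := coded @^-1` B `&` `[0, 1[%classic.
have mE : measurable E.
  apply: measurableI; last exact: measurable_itv.
  by rewrite -[X in measurable X]setTI; exact: measurable_coded.
have [mbad bad0] := bad_null p.
have mEb : measurable (E `\` bad p) by exact: measurableD.
have Eoo : (lebesgue_measure (E `\` bad p) < +oo)%E.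
  apply: (@le_lt_trans _ _ (lebesgue_measure (`[0%R, 1%R[%classic : set R))).
    apply: le_measure; [exact/mem_set|apply/mem_set; exact: measurable_itv|].
    by move=> x [[]].
  by rewrite lebesgue_measure_itv/= lte_fin ltr01 oppr0 adde0 ltry.
have [K [cK KE Ke]] := lebesgue_regularity_inner mEb Eoo e0.
have cL : compact (coded @` K).
  apply: continuous_compact cK; apply: coded_continuous.
  by move=> x /KE[[]].
have mK : measurable K by exact: compact_measurable.
have mL := borel_compact_measurable hX cL.
apply: (@le_trans _ _ (P (coded @` K) + e%:E)%E); last first.
  rewrite leeD2r//; apply: ereal_sup_ubound; exists (coded @` K) => //; split => //.
  by move=> _ [x /KE[[]] + _ _ <-].
rewrite !PE -/E.
apply: (@le_trans _ _ (lebesgue_measure (bad p) +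
    (lebesgue_measure K + lebesgue_measure ((E `\` bad p) `\` K)))%E).
  have mD : measurable ((E `\` bad p) `\` K) by exact: measurableD.
  have mKD : measurable (K `|` ((E `\` bad p) `\` K)) by exact: measurableU.
  apply: (@le_trans _ _
      (lebesgue_measure (bad p `|` (K `|` ((E `\` bad p) `\` K))))).
    apply: le_measure; [exact/mem_set|apply/mem_set; exact: measurableU|].
    move=> x Ex; have [|nb] := pselect (bad p x); first by left.
    by have [|nK] := pselect (K x); right; [left|right].
  apply: (le_trans (measureU2 (@lebesgue_measure R) mbad mKD)); rewrite leeD2l//.
  exact: measureU2.
rewrite bad0 add0e; apply: leeD; last exact: ltW.
apply: le_measure; rewrite ?inE//.
  apply: measurableI; last exact: measurable_itv.
  by rewrite -[X in measurable X]setTI; exact: measurable_coded.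
by move=> x Kx; split; [exists x|have [[]] := KE _ Kx].
Qed.

(** [coded] intertwines [branch p i] with [w i], which transports the self-similarity of Lebesgue
    measure, and its values lie in [A]. *)
Lemma markov_invariant_exists :
  exists2 mu : radonProbability X R,
    invariant_measure (markov_operator w p hX) mu & mu (~` A) = 0%E.
Proof.
have [mu muE] := coded_radon; exists mu; last first.
  rewrite muE (_ : _ `&` _ = set0) ?measure0//.
  apply/seteqP; split=> // x [+ _]; apply.
  exact: (coding_in wA ptP).
move=> B mB; change (markov_fun w p mu B = mu B).
have mE : measurable (coded @^-1` B).
  by rewrite -[X in measurable X]setTI; exact: measurable_coded.
rewrite muE (lebesgue_self_similar p mE); apply: eq_bigr => i _.
congr (_ * _)%E; rewrite /pushforward muE; congr lebesgue_measure.
apply/seteqP; split=> x [Bx x01]; split => //; move: Bx;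
  by rewrite /= coded_branch.
Qed.

End invariant.

(** * Support of the invariant measure and conclusion *)

(** By invariance an open set has at least [p i] times the mass of its preimage under [w i];
    positivity thus passes from preimage to set, one letter at a time. *)
Lemma invariant_open_gt0 (R : realType) (X : ptopologicalType)
    (hX : hausdorff_space X) (n : nat) (w : 'I_n.+1 -> continuousType X X)
    (p : probVector R n.+1) (mu : radonProbability X R) alpha k (U : set X) :
  invariant_measure (markov_operator w p hX) mu -> open U ->
  (0 < mu (word_map w alpha k @^-1` U))%E -> (0 < mu U)%E.
Proof.
move=> Mmu; elim: k U => // k IH U oU.
rewrite [word_map _ _ _]/= comp_preimage => muU.
have oV : open (word_map w alpha k @^-1` U).
  by have /continuousP := @word_map_continuous X n w alpha k; apply.
apply: IH => //; rewrite -Mmu; last exact: sub_sigma_algebra.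
change (0 < markov_fun w p mu (word_map w alpha k @^-1` U))%E.
rewrite /markov_fun (bigD1 (alpha k))//=.
have p0 i : (0 < (p i)%:E)%E by rewrite lte_fin prob_vector_gt0.
apply: lt_le_trans (mule_gt0 (p0 (alpha k)) muU) _; rewrite leeDl//.
by apply: sume_ge0 => i _; apply: mule_ge0; [exact: ltW|rewrite /pushforward; exact: measure_ge0].
Qed.

(** The complement of [A] is open and null. Conversely, an open set around a point of [A] contains
    the image of [A] under some word, so its preimage under that word contains [A] and has full
    mass. *)
Lemma msupport_invariant (R : realType) (X : ptopologicalType)
    (hX : hausdorff_space X) (n : nat) (w : 'I_n.+1 -> continuousType X X)
    (hw : tifs w) (p : probVector R n.+1) (A : compacts X)
    (wA : hutchinson_set w A = A) (pt : (nat -> 'I_n.+1) -> X)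
    (ptP : forall alpha, \bigcap_(k in [set k | (0 < k)%N])
       (word_map w alpha k @` A) = [set pt alpha])
    (mu : radonProbability X R) :
  invariant_measure (markov_operator w p hX) mu -> mu (~` A) = 0%E ->
  msupport mu = A.
Proof.
move=> Mmu muA.
have cA := compact_closed hX (@compacts_compact _ A).
apply/seteqP; split=> x.
  move=> xsupp; apply: contrapT => nAx.
  by have := xsupp (~` A) (closed_openC cA) nAx; rewrite muA ltxx.
move=> Ax U oU Ux.
have [alpha ax] := coding_onto wA ptP Ax.
move: Ux; rewrite -ax => Ux.
have [k kU] := coding_nbhs hX hw wA ptP oU Ux.
apply: (@invariant_open_gt0 R X hX n w p mu alpha k) => //.
have mA := borel_compact_measurable hX (@compacts_compact _ A).
apply: (@lt_le_trans _ _ (mu A)).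
  rewrite -[X in mu X]setCK (@probability_setC _ _ _ mu (~` A)); last exact: measurableC.
  by rewrite muA sube0 lte01.
apply: le_measure; rewrite ?inE//.
  apply: sub_sigma_algebra.
  by have /continuousP := @word_map_continuous X n w alpha k; apply.
by move=> y Ay; apply: kU; exists y.
Qed.

Theorem theorem3p13 (R : realType) (X : ptopologicalType)
    (hX : hausdorff_space X) (n : nat) (w : 'I_n.+1 -> continuousType X X)
    (hw : tifs w) (A : compacts X) (hA : attractor w A)
    (p : probVector R n.+1) :
  let M := markov_operator w p hX in
  exists mu_star : radonProbability X R,
    [/\ (* (i) *)
        invariant_measure M mu_star /\
        (forall mu : radonProbability X R,
           weakly_converges (fun k => iter k M mu) mu_star),
        (* (ii) *)
        msupport mu_star = A &
        (* (iii) *)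
        (compact (msupport mu_star) /\
         forall nu : radonProbability X R, compact (msupport nu) ->
           invariant_measure M nu -> measure_eq nu mu_star) /\
        (normal_space X ->
         forall nu : radonProbability X R,
           invariant_measure M nu -> measure_eq nu mu_star)].
Proof.
move=> M.
have wA : hutchinson_set w A = A := congr1 (@compacts_val X) hA.1.
have stableA : hutchinson_set w A `<=` A by rewrite wA.
(* The singletons of the second TIFS condition, taken at [A], define the coding map [pt]. *)
have [pt ptP] := choice (hw.2 A stableA).
have [mu Mmu muA] := markov_invariant_exists hX p hw wA ptP.
have suppA := msupport_invariant hw wA ptP Mmu muA.
exists mu; split.
- by split=> // nu; exact: weakly_converges_iter_markov.
- exact: suppA.
- split; last by move=> _ nu Mnu; exact: (invariant_measure_unique hw Mnu Mmu).
  split; first by rewrite suppA; exact: compacts_compact.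
  by move=> nu _ Mnu; exact: (invariant_measure_unique hw Mnu Mmu).
Qed.
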